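(* For an integer $q\ge 2$, let $L_q$ denote the maximum of $|E_1|+|E_2|$ over all admissible sets $E_2$ of 2-edges for the incidence graph of $K_{q+1}$ (as defined in the context), so that $L_q = q(q+1)+\max|E_2|$. Then \[ L_3=14,\qquad L_4=26,\qquad L_5\ge 43,\qquad L_6\ge 64,\qquad L_7\ge 88. \] In the notation $z_L\!\left(\binom{q+1}{2},q+1\right)=L_q$ (the limited augmented Zarankiewicz number in the incidence-graph family of complete graphs), this reads $z_L(6,4)=14$, $z_L(10,5)=26$, $z_L(15,6)\ge 43$, $z_L(21,7)\ge 64$, $z_L(28,8)\ge 88$.
   Context: Fix an integer $q\ge 2$ and let $V=\{0,1,\dots,q\}$, $S=\binom{V}{2}$ (the set of $2$-element subsets of $V$, called rows), and $T=V$ (called columns). A cell is an element of $S\times T$. Let $E_1=\{(r,c)\in S\times T: c\in r\}$; then $G_1=(S,T,E_1)$ is the incidence graph of $K_{q+1}$, with $|E_1|=q(q+1)$, and its elements are called 1-edges. A 2-edge is a pair of cells $\{(r_1,c_1),(r_2,c_2)\}$ (its two halves), written $(i_1i_2,i_3;i_4i_5,i_6)$ when $r_1=\{i_1,i_2\}$, $c_1=i_3$, $r_2=\{i_4,i_5\}$, $c_2=i_6$. A 2-edge is nondegenerate if $r_1\ne r_2$ and $c_1\ne c_2$. Given a set $E_2$ of 2-edges, a cell is occupied if it lies in $E_1$ or is a half of some 2-edge in $E_2$. The set $E_2$ is admissible if it satisfies: (S) No 2-edge shares a cell with a 1-edge or with another 2-edge, and the two halves of each 2-edge are distinct cells (so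 the case $r_1=r_2$, $c_1=c_2$ is excluded). (C2) For every nondegenerate 2-edge $\{(r_1,c_1),(r_2,c_2)\}\in E_2$, the two cells $(r_1,c_2)$ and $(r_2,c_1)$ are not both occupied. (C3) There do not exist a 2-edge $\{(r_1,c_1),(r_2,c_2)\}\in E_2$ and a cell $(x,y)$ with $x\notin\{r_1,r_2\}$ and $y\notin\{c_1,c_2\}$ such that the five cells $(x,y),(x,c_1),(x,c_2),(r_1,y),(r_2,y)$ are all occupied (where, if the 2-edge is nondegenerate, these five cells are additionally required to be pairwise distinct). *)

(* Defs.v *)
From mathcomp Require Import all_boot.

Set Implicit Arguments.
Unset Strict Implicit.
Unset Printing Implicit Defensive.

(* The vertex set V = {0, ..., q} of K_{q+1} is 'I_q.+1; it is also the set T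
   of columns. *)
Definition row (q : nat) := {r : {set 'I_q.+1} | #|r| == 2}.
Definition cell (q : nat) := (row q * 'I_q.+1)%type.

Definition E1 (q : nat) : {set cell q} := [set x : cell q | x.2 \in val x.1].

(* A 2-edge is an unordered pair of cells, represented as [set a; b]; the case
   a = b is only excluded by condS. *)
Definition is_2edge (q : nat) (e : {set cell q}) : bool :=
  [exists a, exists b, e == [set a; b]].

Definition nondegenerate (q : nat) (a b : cell q) : bool :=
  (a.1 != b.1) && (a.2 != b.2).

Definition occupied (q : nat) (E2 : {set {set cell q}}) : {set cell q} :=
  E1 q :|: cover E2.

Definition condS (q : nat) (E2 : {set {set cell q}}) : bool :=
  [&& [forall e in E2, [disjoint e & E1 q]],
      trivIset E2
    & [forall a, forall b, ([set a; b] \in E2) ==> (a != b)]].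

Definition condC2 (q : nat) (E2 : {set {set cell q}}) : bool :=
  [forall a, forall b, ([set a; b] \in E2) && nondegenerate a b ==>
    ~~ (((a.1, b.2) \in occupied E2) && ((b.1, a.2) \in occupied E2))].

Definition five_cells (q : nat) (a b : cell q) (x : row q) (y : 'I_q.+1) :
    seq (cell q) :=
  [:: (x, y); (x, a.2); (x, b.2); (a.1, y); (b.1, y)].

Definition condC3 (q : nat) (E2 : {set {set cell q}}) : bool :=
  ~~ [exists a, exists b, exists x : row q, exists y : 'I_q.+1,
       [&& [set a; b] \in E2,
           x \notin [:: a.1; b.1],
           y \notin [:: a.2; b.2],
           all (mem (occupied E2)) (five_cells a b x y)
         & nondegenerate a b ==> uniq (five_cells a b x y)]].

Definition admissible (q : nat) (E2 : {set {set cell q}}) : bool :=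
  [&& [forall e in E2, is_2edge e], condS E2, condC2 E2 & condC3 E2].

(* The empty E2 is always admissible, so this is a maximum over a nonempty
   finite family. *)
Definition L (q : nat) : nat :=
  \max_(E2 : {set {set cell q}} | admissible E2) (#|E1 q| + #|E2|).

(* Main.v *)
Require Import Defs.
From mathcomp Require Import all_boot.

Set Implicit Arguments.
Unset Strict Implicit.
Unset Printing Implicit Defensive.

(** Lower bounds come from explicit admissible sets found by local search (for
    q = 6 and q = 7 among sets invariant under a group of vertex permutations);
    for q = 6 the set found even has 24 > 22 elements.

    For the upper bounds, admissibility passes to subsets and is invariant under
    relabelling the vertices. For q = 4 exactly 285 2-edges are admissible on
    their own, and they form five orbits under the symmetric group. One orbit
    after the other is shown to be avoidable: an admissible set of 7 2-edges
    that meets the orbit would, after relabelling, contain a fixed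
    representative, and a branch-and-bound search for 6 more 2-edges outside the
    orbits already treated fails. The bound of the search: a cell lies on at
    most one chosen 2-edge, so when m + 1 more 2-edges are wanted, those through
    m selected cells may be left unbranched. *)

(** * The search program *)

Definition code := (nat * nat)%type.
Definition edge := (code * code)%type.
Definition matrix := seq (seq bool).

Definition row_pairs (n : nat) : seq (nat * nat) :=
  [seq ij <- [seq (i, j) | i <- iota 0 n, j <- iota 0 n] | ij.1 < ij.2].

Definition codes (n : nat) : seq code :=
  [seq (r, c) | r <- iota 0 (size (row_pairs n)), c <- iota 0 n].

Fixpoint pairs (T : Type) (s : seq T) : seq (T * T) :=
  if s is x :: s' then [seq (x, y) | y <- s'] ++ pairs s' else [::].

Definition E1_matrix (n : nat) : matrix :=
  [seq [seq (c == ij.1) || (c == ij.2) | c <- iota 0 n] | ij <- row_pairs n].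

(* Rows of a matrix are indexed by [row_pairs]; its marked entries stand for the
   occupied cells, those of E1 included. *)
Definition get (M : matrix) (k : code) : bool := nth false (nth [::] M k.1) k.2.

Definition mark (M : matrix) (k : code) : matrix :=
  set_nth [::] M k.1 (set_nth false (nth [::] M k.1) k.2 true).

Definition mark_edge (M : matrix) (e : edge) : matrix := mark (mark M e.1) e.2.

(* Conditions (C2) and (C3) for the 2-edge [e] when M marks the occupied cells.
   Conditionals replace some conjunctions because [&&] evaluates both sides under
   call by value. The distinctness clause of (C3) holds automatically for a
   nondegenerate 2-edge and is left out. *)
Definition violates (n : nat) (M : matrix) (e : edge) : bool :=
  let: ((r1, c1), (r2, c2)) := e in
  let R1 := nth [::] M r1 in
  let R2 := nth [::] M r2 in
  if [&& nth false R1 c2, nth false R2 c1, r1 != r2 & c1 != c2] then true else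
  has (fun xX : nat * seq bool => let X := xX.2 in
    if nth false X c1 then if nth false X c2 then
      [&& xX.1 != r1, xX.1 != r2 &
       has (fun y => [&& nth false X y, nth false R1 y, nth false R2 y,
                         y != c1 & y != c2]) (iota 0 n)]
    else false else false) (zip (iota 0 (size M)) M).

Definition compat (n : nat) (cur : seq edge) (M : matrix) (u : edge) : bool :=
  if get M u.1 then false else if get M u.2 then false else
  let M' := mark_edge M u in ~~ has (violates n M') (u :: cur).

Definition thru (k : code) (e : edge) : bool := (e.1 == k) || (e.2 == k).

Definition edges_matrix (n : nat) (w : seq edge) : matrix :=
  foldr (fun e M => mark_edge M e) (E1_matrix n) w.

(** A greedy choice of up to m cells, each the first half of the first edge still left. The stars at
    these cells form the first component and go unbranched. *)
Fixpoint stars (m : nat) (s : seq edge) : seq edge * seq edge :=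
  match m, s with
  | m'.+1, e :: _ =>
    let t := stars m' (filter (predC (thru e.1)) s) in
    (filter (thru e.1) s ++ t.1, t.2)
  | _, _ => ([::], s)
  end.

(* [true] certifies that no m elements of [s] extend [cur] to an admissible set;
   M marks the cells occupied by [cur]. *)
Fixpoint search (n m : nat) (cur : seq edge) (M : matrix) (s : seq edge) : bool :=
  if m is m'.+1 then
    let t := stars m' s in
    (fix go br := if br is v :: br' then
       let M' := mark_edge M v in
       let s' := filter (compat n (v :: cur) M') (t.1 ++ br') in
       if (if size s' < m' then true else search n m' (v :: cur) M' s')
       then go br' else false
     else true) t.2
  else false.

Fixpoint perms_of (s : seq nat) : seq (seq nat) :=
  if s is x :: s' then
    flatten [seq [seq take i t ++ x :: drop i t | i <- iota 0 (size t).+1]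
            | t <- perms_of s']
  else [:: [::]].

Definition act (n : nat) (s : seq nat) (k : code) : code :=
  let: (i, j) := nth (0, 0) (row_pairs n) k.1 in
  let i' := nth 0 s i in let j' := nth 0 s j in
  (index (if i' < j' then (i', j') else (j', i')) (row_pairs n), nth 0 s k.2).

Definition acte (n : nat) (s : seq nat) (e : edge) : edge :=
  (act n s e.1, act n s e.2).

(** [pairs] lists each 2-edge in one order only, and the action may reverse it, so both orders of
    the halves are recorded. *)
Definition orbit_edges (n : nat) (e : edge) : seq edge :=
  flatten [seq [:: acte n s e; (act n s e.2, act n s e.1)] | s <- perms_of (iota 0 n)].

(* [true] certifies that an admissible set with no element in [done], under any
   labelling of the vertices, has at most m elements. *)
Fixpoint exhaust (n m : nat) (done reps : seq edge) : bool :=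
  if reps is r :: reps' then
    let M := mark_edge (E1_matrix n) r in
    let s := [seq e <- pairs (codes n) | compat n [:: r] M e] in
    let s := [seq e <- s | e \notin done] in
    [&& r \in pairs (codes n), search n m [:: r] M s
      & exhaust n m (orbit_edges n r ++ done) reps']
  else all (fun e => if compat n [::] (E1_matrix n) e then e \in done else true)
           (pairs (codes n)).

Definition halves (w : seq edge) : seq code := flatten [seq [:: e.1; e.2] | e <- w].

(** The first two clauses express (S): halves avoid the 1-edges and never repeat. The last one
    covers (C2) and (C3). *)
Definition witness (n : nat) (w : seq edge) : bool :=
  [&& all (fun k => (k \in codes n) && ~~ get (E1_matrix n) k) (halves w),
      uniq (halves w) & all (fun e => ~~ violates n (edges_matrix n w) e) w].

(** * Encoding of cells *)

Section Labelling.

Variables (q : nat) (p : nat -> 'I_q.+1).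
Hypothesis p_inj : {in gtn q.+1 &, injective p}.
Implicit Types (x a b : cell q) (M : matrix).

Local Notation row_ends := (nth (0, 0) (row_pairs q.+1)).

Lemma mem_row_pairs n ij : (ij \in row_pairs n) = (ij.1 < ij.2 < n).
Proof.
case: ij => i j; rewrite mem_filter /=; case: ltnP => //= lt_ij.
apply/allpairsP/idP => [[[i' j'] /= [_ hj [_ ->]]]|lt_jn].
  by rewrite mem_iota in hj.
by exists (i, j); rewrite !mem_iota /= add0n lt_jn (ltn_trans lt_ij).
Qed.

Lemma row_ends_lt r : r < size (row_pairs q.+1) ->
  ((row_ends r).1 < (row_ends r).2 < q.+1).
Proof. by move=> ltr; rewrite -mem_row_pairs mem_nth. Qed.

Lemma row_ends_lt1 r : r < size (row_pairs q.+1) -> (row_ends r).1 < q.+1.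
Proof. by case/row_ends_lt/andP; apply: ltn_trans. Qed.

Lemma row_ends_lt2 r : r < size (row_pairs q.+1) -> (row_ends r).2 < q.+1.
Proof. by case/row_ends_lt/andP. Qed.

Lemma row_pairs_uniq n : uniq (row_pairs n).
Proof. by rewrite filter_uniq // allpairs_uniq ?iota_uniq // => -[? ?] [? ?]. Qed.

Lemma mem_codes n k : (k \in codes n) = (k.1 < size (row_pairs n)) && (k.2 < n).
Proof.
case: k => r c /=; apply/allpairsP/idP => [[[r' c'] /= []]|/andP[hr hc]].
  by rewrite !mem_iota /= !add0n => hr hc [-> ->]; rewrite hr hc.
by exists (r, c); rewrite !mem_iota.
Qed.

Lemma codes_uniq n : uniq (codes n).
Proof. by rewrite allpairs_uniq ?iota_uniq // => -[? ?] [? ?]. Qed.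

(** An injective self-map of a finite set is bijective. *)
Lemma label_surj (c : 'I_q.+1) : exists2 k, k < q.+1 & p k = c.
Proof.
have inj : injective (fun i : 'I_q.+1 => p i).
  by move=> i j /p_inj e; apply/val_inj/e; rewrite inE /=.
exists (invF inj c); first exact: ltn_ord.
by rewrite (f_invF inj).
Qed.

Lemma label_pair_inj i j i' j' : i < j < q.+1 -> i' < j' < q.+1 ->
  [set p i; p j] = [set p i'; p j'] -> (i, j) = (i', j').
Proof.
move=> /andP[ij jq] /andP[ij' jq'] e.
have iq := ltn_trans ij jq; have iq' := ltn_trans ij' jq'.
have: p i \in [set p i'; p j'] by rewrite -e !inE eqxx.
have: p j \in [set p i'; p j'] by rewrite -e !inE eqxx orbT.
rewrite !inE.
have peq u v : u < q.+1 -> v < q.+1 -> (p u == p v) = (u == v).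
  by move=> hu hv; apply/eqP/eqP => [/p_inj->|->].
rewrite !peq //.
(* Besides the straight match, two cases identify i with j, and the crossed case reverses the order
   of the ends. *)
case/orP=> /eqP ej /orP[] /eqP ei; subst; rewrite ?ltnn // in ij ij' *.
by rewrite ltnNge (ltnW ij') in ij.
Qed.

(* The labelling p of the vertices is arbitrary, so that acting by a permutation
   amounts to changing p and no action on sets of cells is needed. *)
Definition encode x : code :=
  (find (fun ij => val x.1 == [set p ij.1; p ij.2]) (row_pairs q.+1),
   find (fun k => p k == x.2) (iota 0 q.+1)).

Lemma encode_row x : (encode x).1 < size (row_pairs q.+1) /\
  val x.1 = [set p (row_ends (encode x).1).1; p (row_ends (encode x).1).2].
Proof.
set P := fun ij => val x.1 == [set p ij.1; p ij.2].
suff hP : has P (row_pairs q.+1).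
  by split; [rewrite -has_find | apply/eqP; exact: (nth_find (0, 0) hP)].
have /cards2P[u [v [uv e]]] : #|val x.1| == 2 := valP x.1.
have [i iq ei] := label_surj u; have [j jq ej] := label_surj v.
apply/hasP; have [lt_ij|lt_ji|eij] := ltngtP i j.
- by exists (i, j); rewrite ?mem_row_pairs /= ?lt_ij // /P /= ei ej e.
- by exists (j, i); rewrite ?mem_row_pairs /= ?lt_ji // /P /= ei ej e setUC.
- by rewrite -ei -ej eij eqxx in uv.
Qed.

Lemma encode_col x : (encode x).2 < q.+1 /\ p (encode x).2 = x.2.
Proof.
set P := fun k => p k == x.2.
have hP : has P (iota 0 q.+1).
  have [k kq ek] := label_surj x.2.
  by apply/hasP; exists k; rewrite ?mem_iota // /P ek.
have lt : find P (iota 0 q.+1) < q.+1 by rewrite -[X in _ < X](size_iota 0) -has_find.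
split=> //; have /eqP := nth_find 0 hP.
by rewrite nth_iota.
Qed.

Lemma encode_codes x : encode x \in codes q.+1.
Proof. by rewrite mem_codes (encode_row x).1 (encode_col x).1. Qed.

(** Describes codes by the labels of row ends and column, so that different labellings can be
    compared without unfolding [find]. *)
Lemma encodeP k x : k \in codes q.+1 ->
  (encode x = k) <->
  (val x.1 = [set p (row_ends k.1).1; p (row_ends k.1).2] /\ x.2 = p k.2).
Proof.
rewrite mem_codes => /andP[k1 k2]; split=> [<-|[e1 e2]].
  by rewrite (encode_col x).2 -(encode_row x).2.
have [c2 cc] := encode_col x; have [r1 rr] := encode_row x.
apply: injective_projections; last by apply: p_inj; rewrite // cc.
apply/eqP; rewrite -(nth_uniq (0, 0) r1 k1 (row_pairs_uniq _)); apply/eqP.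
rewrite [LHS]surjective_pairing [RHS]surjective_pairing.
by apply: label_pair_inj; rewrite ?row_ends_lt // -e1 -rr.
Qed.

Lemma encode_inj : injective encode.
Proof.
move=> x y e; have [ex1 ex2] := (encodeP x (encode_codes y)).1 e.
apply: injective_projections; last by rewrite ex2 (encode_col y).2.
by apply: val_inj; rewrite ex1 -(encode_row y).2.
Qed.

Lemma encode_surj k : k \in codes q.+1 -> exists x, encode x = k.
Proof.
move=> kc; have := kc; rewrite mem_codes => /andP[k1 k2].
have h : #|[set p (row_ends k.1).1; p (row_ends k.1).2]| == 2.
  rewrite cards2 eqSS eqb1; apply/eqP => /p_inj e.
  have := row_ends_lt k1; rewrite e ?ltnn //; by [exact: row_ends_lt1 | exact: row_ends_lt2].
by exists (exist (fun r : {set 'I_q.+1} => #|r| == 2) _ h, p k.2); apply/encodeP.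
Qed.

Definition marked M : {set cell q} := [set x | get M (encode x)].

Lemma marked_E1_matrix : marked (E1_matrix q.+1) = E1 q.
Proof.
apply/setP => x; rewrite !inE /get.
have [r1 rr] := encode_row x; have [c1 cc] := encode_col x.
rewrite (nth_map (0, 0)) // (nth_map 0) ?size_iota // nth_iota // add0n.
rewrite rr -cc !inE.
have peq u v : u < q.+1 -> v < q.+1 -> (p u == p v) = (u == v).
  by move=> hu hv; apply/eqP/eqP => [/p_inj->|->].
by rewrite !peq // ?row_ends_lt1 ?row_ends_lt2.
Qed.

Lemma get_mark M k k' : get (mark M k) k' = (k' == k) || get M k'.
Proof.
case: k k' => r c [r' c']; rewrite /get /mark /= nth_set_nth /= xpair_eqE.
by case: (r' =P r) => [->|//]; rewrite nth_set_nth /=; case: eqP.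
Qed.

Lemma size_mark n M k : size M = size (row_pairs n) -> k \in codes n ->
  size (mark M k) = size (row_pairs n).
Proof.
rewrite mem_codes size_set_nth => -> /andP[lt _].
by apply/maxn_idPr.
Qed.

Lemma zip_iota M :
  zip (iota 0 (size M)) M = [seq (i, nth [::] M i) | i <- iota 0 (size M)].
Proof.
apply: (@eq_from_nth _ (0, [::])); first by rewrite size_map size1_zip size_iota.
move=> i; rewrite size1_zip ?size_iota // => lt.
by rewrite nth_zip ?size_iota // (nth_map 0) ?size_iota // nth_iota.
Qed.

(** Failure of (C2) or (C3), with the occupied set as a parameter so that the test also applies to a
    partial choice of 2-edges. *)
Definition conflict (O : {set cell q}) a b : bool :=
  (nondegenerate a b && (((a.1, b.2) \in O) && ((b.1, a.2) \in O))) ||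
  [exists x : row q, exists y : 'I_q.+1,
    [&& x \notin [:: a.1; b.1], y \notin [:: a.2; b.2]
      & all (mem O) (five_cells a b x y)]].

Lemma encode_eq1 a b : ((encode a).1 == (encode b).1) = (a.1 == b.1).
Proof.
apply/eqP/eqP => [e|e]; last by rewrite /encode e.
by apply: val_inj; rewrite (encode_row a).2 e -(encode_row b).2.
Qed.

Lemma encode_eq2 a b : ((encode a).2 == (encode b).2) = (a.2 == b.2).
Proof.
apply/eqP/eqP => [e|e]; last by rewrite /encode e.
by rewrite -(encode_col a).2 e (encode_col b).2.
Qed.

(** Removes the conditionals and the [zip] of the program, leaving a form that can be matched with
    [conflict]. *)
Lemma violates_codeE n M r1 c1 r2 c2 :
  violates n M ((r1, c1), (r2, c2)) =
    ([&& get M (r1, c2), get M (r2, c1), r1 != r2 & c1 != c2] ||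
     has (fun r => [&& get M (r, c1), get M (r, c2), r != r1, r != r2 &
       has (fun c => [&& get M (r, c), get M (r1, c), get M (r2, c),
                         c != c1 & c != c2]) (iota 0 n)]) (iota 0 (size M))).
Proof.
rewrite /violates /get /=; case: ifP => //= _; rewrite zip_iota has_map.
by apply: eq_has => r /=; do 2?case: (nth false _ _).
Qed.

Lemma violatesE M a b : size M = size (row_pairs q.+1) ->
  violates q.+1 M (encode a, encode b) = conflict (marked M) a b.
Proof.
move=> sM; rewrite [encode a]surjective_pairing [encode b]surjective_pairing violates_codeE.
have mE x y : ((x.1, y.2) \in marked M) = get M ((encode x).1, (encode y).2).
  by rewrite inE.
rewrite /conflict /nondegenerate !mE -encode_eq1 -encode_eq2 andbA [LHS]orbC [RHS]orbC.
congr (_ || _); last by rewrite andbC.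
apply/hasP/existsP => [[r]|[x /existsP[y]]].
  rewrite mem_iota sM add0n => /andP[_ r1] /and5P[ra rb rna rnb].
  (* Only whole cells have codes, so the row index is completed by the arbitrary column 0. *)
  have [|x ex] := @encode_surj (r, 0); first by rewrite mem_codes r1.
  have {}ex : r = (encode x).1 by rewrite ex.
  subst r; case/hasP=> c; rewrite mem_iota add0n => /andP[_ c1].
  case/and5P=> xc ac bc cna cnb.
  have [|y ey] := @encode_surj ((encode x).1, c); first by rewrite mem_codes r1.
  have {}ey : c = (encode y).2 by rewrite ey.
  subst c; exists x.1; apply/existsP; exists y.2.
  rewrite !inE !negb_or -!encode_eq1 -!encode_eq2 rna rnb cna cnb /five_cells.
  by rewrite [all _ _]/= !mE ra rb xc ac bc.
have [z [-> ->]] : exists z : cell q, x = z.1 /\ y = z.2 by exists (x, y).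
rewrite !inE !negb_or -!encode_eq1 -!encode_eq2.
rewrite /five_cells [all _ _]/= !mE andbT.
case/and3P=> /andP[za zb] /andP[ya yb] /and5P[zz xa xb ay yy].
exists (encode z).1; first by rewrite mem_iota sM (encode_row z).1.
rewrite xa xb za zb; apply/hasP; exists (encode z).2.
  by rewrite mem_iota (encode_col z).1.
by rewrite zz ay yy ya yb.
Qed.

End Labelling.

(** * Soundness of the search *)

Lemma mem_pairs (T : eqType) (s : seq T) (x y : T) : uniq s ->
  ((x, y) \in pairs s) = (index x s < index y s < size s).
Proof.
elim: s => //= z s IH /andP[zs us]; rewrite mem_cat {}IH //.
have -> : ((x, y) \in [seq (z, y0) | y0 <- s]) = (x == z) && (y \in s).
  apply/mapP/andP => [[t ts [-> ->]]|[/eqP-> ys]]; first by rewrite eqxx.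
  by exists y.
rewrite ![z == _]eq_sym.
have [->|] := eqVneq x z; have [->|] := eqVneq y z => //=.
- by rewrite (negbTE zs) ltnn.
- by move=> _; rewrite ltnS index_mem orbC andbC; case: (y \in s); rewrite ?orbT ?andbF.
- by move=> _; rewrite (memNindex zs) ltnn andbF.
Qed.

Lemma pairs_uniq (T : eqType) (s : seq T) : uniq s -> uniq (pairs s).
Proof.
elim: s => //= z s IH /andP[zs us]; rewrite cat_uniq IH // andbT.
rewrite map_inj_uniq ?us //=; last by move=> ? ? [].
apply/hasPn => -[x y]; rewrite mem_pairs // => /andP[xy ys].
apply/mapP => -[t ts [ex _]].
by move: zs; rewrite -ex -index_mem (ltn_trans xy ys).
Qed.

(** Listed pairs are ordered by index in [s], which excludes a match of the components in crossed
    order. *)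
Lemma pairs_inj (T : eqType) (s : seq T) (e f : T * T) : uniq s ->
  e \in pairs s -> f \in pairs s ->
  e.1 \in [:: f.1; f.2] -> e.2 \in [:: f.1; f.2] -> e = f.
Proof.
move=> us; case: e f => [x y] [x' y'] /=.
rewrite !mem_pairs // !inE => /andP[xy _] /andP[xy' _].
case/orP=> /eqP ex /orP[] /eqP ey; subst; rewrite ?ltnn // in xy xy' *.
by rewrite ltnNge (ltnW xy) in xy'.
Qed.

Lemma mem_pairs_codes n e : e \in pairs (codes n) ->
  (e.1 \in codes n) && (e.2 \in codes n).
Proof.
case: e => x y; rewrite mem_pairs ?codes_uniq // => /andP[xy yn] /=.
by rewrite -!index_mem yn (ltn_trans xy yn).
Qed.

Lemma perms_of_perm s t : t \in perms_of s -> perm_eq t s.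
Proof.
elim: s t => [|x s IH] t; first by rewrite inE => /eqP->.
case/flatten_mapP=> u /IH us /mapP[i _ ->].
by rewrite perm_catC /= perm_cons perm_catC cat_take_drop.
Qed.

Lemma count_leq (T : eqType) (a : pred T) (s t : seq T) : uniq s ->
  (forall x, x \in s -> a x -> x \in t) -> count a s <= count a t.
Proof.
move=> us st; rewrite -!size_filter uniq_leq_size ?filter_uniq // => x.
by rewrite !mem_filter => /andP[ax xs]; rewrite ax st.
Qed.

Lemma get_mark_edge M e k : get (mark_edge M e) k = thru k e || get M k.
Proof.
rewrite /mark_edge !get_mark /thru orbA; congr (_ || _).
by rewrite orbC ![k == _]eq_sym.
Qed.

Lemma get_edges_matrix n w k :
  get (edges_matrix n w) k = has (thru k) w || get (E1_matrix n) k.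
Proof. by elim: w => //= e w IH; rewrite get_mark_edge IH orbA. Qed.

Lemma size_edges_matrix n w : all (mem (codes n)) (halves w) ->
  size (edges_matrix n w) = size (row_pairs n).
Proof.
elim: w => [|e w IH] /=; first by rewrite size_map.
by case/and3P=> e1 e2 /IH sw; rewrite /mark_edge; apply: size_mark e2; apply: size_mark e1.
Qed.

Lemma stars_cons m e s : stars m.+1 (e :: s) =
  (filter (thru e.1) (e :: s) ++ (stars m (filter (predC (thru e.1)) (e :: s))).1,
   (stars m (filter (predC (thru e.1)) (e :: s))).2).
Proof. by []. Qed.

Lemma stars_perm m s : perm_eq ((stars m s).1 ++ (stars m s).2) s.
Proof.
elim: m s => [|m IH] [|e s] //; rewrite stars_cons; move: (e :: s) => {}s.
rewrite -catA perm_sym -(perm_filterC (thru e.1) s) perm_cat2l perm_sym.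
exact: IH.
Qed.

(** This monotonicity makes pruning sound: a conflict within a partial choice persists in every
    larger one. *)
Lemma conflict_sub q (O O' : {set cell q}) a b : O \subset O' ->
  conflict O a b -> conflict O' a b.
Proof.
move=> /subsetP sO /orP[/andP[ab /andP[/sO h1 /sO h2]]|].
  by apply/orP; left; rewrite ab h1.
case/existsP=> x /existsP[y /and3P[xa yb /allP h]].
apply/orP; right; apply/existsP; exists x; apply/existsP; exists y.
by rewrite xa yb; apply/allP => z /h /sO.
Qed.

Lemma admissible_conflict q (E2 : {set {set cell q}}) a b :
  admissible E2 -> [set a; b] \in E2 -> ~~ conflict (occupied E2) a b.
Proof.
case/and4P=> _ _ c2 c3 ab; rewrite negb_or; apply/andP; split.
  apply/andP => -[nd h].
  by have /forallP/(_ a)/forallP/(_ b) := c2; rewrite ab nd /= h.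
apply: contra c3 => /existsP[x /existsP[y /and3P[hx hy h]]].
apply/existsP; exists a; apply/existsP; exists b.
apply/existsP; exists x; apply/existsP; exists y.
(* The five cells are distinct: x avoids both rows, y avoids both columns, and nondegeneracy
   separates the two rows and the two columns. *)
apply/and5P; split=> //; apply/implyP; rewrite /nondegenerate => /andP[n1 n2].
move: hx hy; rewrite !inE !negb_or /= !inE !xpair_eqE.
case/andP=> xa xb /andP[ya yb].
by rewrite (negbTE ya) (negbTE yb) (negbTE xa) (negbTE xb) (negbTE n1) (negbTE n2) !andbF.
Qed.

Lemma conflict_admissible q (E2 : {set {set cell q}}) :
  [forall e in E2, is_2edge e] -> condS E2 ->
  (forall a b, [set a; b] \in E2 -> ~~ conflict (occupied E2) a b) ->
  admissible E2.
Proof.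
move=> h2 hS hb; apply/and4P; split=> //.
  apply/forallP => a; apply/forallP => b; apply/implyP => /andP[ab nd].
  by have := hb a b ab; rewrite negb_or nd => /andP[].
apply/existsP => -[a /existsP[b /existsP[x /existsP[y /and5P[ab hx hy h _]]]]].
have := hb a b ab; rewrite negb_or => /andP[_ /negP[]].
by apply/existsP; exists x; apply/existsP; exists y; rewrite hx hy.
Qed.

(** * Coded 2-edges and the members of a fixed admissible set *)

Section Edges.

Variables (q : nat) (p : nat -> 'I_q.+1).
Hypothesis p_inj : {in gtn q.+1 &, injective p}.

Local Notation encode := (encode p).
Local Notation alle := (pairs (codes q.+1)).

Definition decode (e : edge) : {set cell q} := [set x | thru (encode x) e].

Lemma decode_encode a b : decode (encode a, encode b) = [set a; b].
Proof.
apply/setP => x; rewrite !inE /thru /= ![_ == encode x]eq_sym.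
by rewrite !(inj_eq (encode_inj p_inj)).
Qed.

Lemma edge_encodeP e : e \in alle -> exists a b, e = (encode a, encode b).
Proof.
case: e => k l /mem_pairs_codes /= /andP[/(encode_surj p_inj)[a <-]].
by case/(encode_surj p_inj)=> b <-; exists a, b.
Qed.

Lemma decode_inj e f : e \in alle -> f \in alle -> decode e = decode f -> e = f.
Proof.
move=> he hf ef; apply: (pairs_inj (codes_uniq q.+1) he hf).
  have [a [b ee]] := edge_encodeP he; have : a \in decode e by rewrite ee decode_encode !inE eqxx.
  by rewrite ef !inE ee /thru /= ![encode a == _]eq_sym.
have [a [b ee]] := edge_encodeP he; have : b \in decode e by rewrite ee decode_encode !inE eqxx orbT.
by rewrite ef !inE ee /thru /= ![encode b == _]eq_sym.
Qed.

Lemma decode_onto a b : a != b -> exists2 e, e \in alle & decode e = [set a; b].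
Proof.
move=> ab; have ha := encode_codes p_inj a; have hb := encode_codes p_inj b.
have [lt|lt|e] := ltngtP (index (encode a) (codes q.+1)) (index (encode b) (codes q.+1)).
- by exists (encode a, encode b); rewrite ?decode_encode // mem_pairs ?codes_uniq // lt index_mem.
- exists (encode b, encode a); rewrite ?decode_encode 1?setUC //.
  by rewrite mem_pairs ?codes_uniq // lt index_mem.
have := congr1 (nth (0, 0) (codes q.+1)) e; rewrite !nth_index // => /(encode_inj p_inj) eab.
by rewrite eab eqxx in ab.
Qed.

Lemma marked_edges_matrix w :
  marked p (edges_matrix q.+1 w) = E1 q :|: cover [set:: map decode w].
Proof.
rewrite -(marked_E1_matrix p_inj); apply/setP => x; rewrite !inE get_edges_matrix orbC.
congr (_ || _); apply/hasP/bigcupP => [[e ew xe]|[D]].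
  by exists (decode e); rewrite !inE ?map_f.
by rewrite inE => /mapP[e ew ->]; rewrite inE => xe; exists e.
Qed.

Section Search.

Variable E2 : {set {set cell q}}.
Hypothesis admE2 : admissible E2.

Definition inE2 e := decode e \in E2.

(** This is the disjointness of 2-edges in (S), read on codes. *)
Lemma inE2_eq k e f : e \in alle -> f \in alle -> inE2 e -> inE2 f ->
  thru k e -> thru k f -> e = f.
Proof.
move=> he hf ie jf ke kf; apply: decode_inj => //; apply/eqP.
have /and4P[_ /and3P[_ /trivIsetP tI _] _ _] := admE2.
apply/negP => /negP /(tI _ _ ie jf) /pred0P.
have /(encode_surj p_inj)[x ex] : k \in codes q.+1.
  by have /andP[? ?] := mem_pairs_codes he; case/orP: ke => /eqP <-.
by move/(_ x); rewrite /= !inE ex ke kf.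
Qed.

Lemma inE2_free k e : e \in alle -> inE2 e -> thru k e -> get (E1_matrix q.+1) k = false.
Proof.
move=> he ie ke; have /and4P[_ /and3P[/forallP/(_ (decode e)) + _ _] _ _] := admE2.
rewrite [_ \in E2]ie /= => /pred0P.
have /(encode_surj p_inj)[x ex] : k \in codes q.+1.
  by have /andP[? ?] := mem_pairs_codes he; case/orP: ke => /eqP <-.
move/(_ x); rewrite /= -(marked_E1_matrix p_inj) !inE ex ke /=.
by [].
Qed.

(** The pruning test never rejects a member of [E2]: by (S) its halves are still unmarked, and a
    conflict among the cells marked so far would be a conflict in [E2]. *)
Lemma compat_inE2 cur u : {subset u :: cur <= alle} -> all inE2 (u :: cur) ->
  u \notin cur -> compat q.+1 cur (edges_matrix q.+1 cur) u.
Proof.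
move=> sub ia ucur; have /andP[iu ic] := ia.
have ha := sub u (mem_head _ _).
have fr k : thru k u -> get (edges_matrix q.+1 cur) k = false.
  move=> ku; rewrite get_edges_matrix (inE2_free ha iu ku) orbF; apply/hasP => -[e ecur ke].
  case/negP: ucur; rewrite (inE2_eq ha _ iu _ ku ke) //.
    by apply: sub; rewrite inE ecur orbT.
  exact: (allP ic).
rewrite /compat !fr /thru ?eqxx ?orbT //.
rewrite -[mark_edge _ _]/(edges_matrix q.+1 (u :: cur)); apply/hasPn => e he.
have [a [b ee]] := edge_encodeP (sub e he).
have := allP ia e he; rewrite ee /inE2 decode_encode => ab.
rewrite violatesE ?size_edges_matrix //; last first.
  apply/allP => k /flatten_mapP[f /sub/mem_pairs_codes/andP[f1 f2]].
  by rewrite !inE => /orP[] /eqP->.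
apply: contra (admissible_conflict admE2 ab).
apply: conflict_sub; rewrite marked_edges_matrix /occupied setUS //.
apply/bigcupsP => D; rewrite inE => /mapP[f fw ->].
exact/bigcup_sup/(allP ia).
Qed.

(** All edges of one star share a cell, so each star contains at most one member of [E2]. *)
Lemma stars_count m s : {subset s <= alle} -> uniq s ->
  count inE2 (stars m s).1 <= m.
Proof.
elim: m s => [|m IH] [|e s] //; rewrite stars_cons; move: (e :: s) => {}s sub us.
rewrite count_cat -[m.+1]add1n leq_add //; last first.
  by apply: IH; rewrite ?filter_uniq // => x; rewrite mem_filter => /andP[_ /sub].
rewrite -size_filter.
have : uniq [seq x <- [seq x <- s | thru e.1 x] | inE2 x] by rewrite !filter_uniq.
have : forall x, x \in [seq x <- [seq x <- s | thru e.1 x] | inE2 x] ->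
    [/\ inE2 x, thru e.1 x & x \in alle].
  by move=> x; rewrite !mem_filter => /and3P[-> -> /sub].
case: [seq x <- _ | _] => [|x [|y l]] // h /=.
have [ix tx ax] := h x (mem_head _ _).
have [|iy ty ay] := h y; first by rewrite !inE eqxx orbT.
by rewrite (inE2_eq ax ay ix iy tx ty) mem_head.
Qed.

(** Since the stars left unbranched cannot supply all the members sought, one of these would be a
    branching edge, and its branch is refuted recursively. *)
Lemma search_count m cur s : all inE2 cur -> {subset cur ++ s <= alle} ->
  uniq (cur ++ s) -> search q.+1 m cur (edges_matrix q.+1 cur) s -> count inE2 s < m.
Proof.
elim: m cur s => // m IH cur s icur sub us /=.
have us2 : uniq s by move: us; rewrite cat_uniq => /and3P[].
have sub2 : {subset s <= alle} by move=> x xs; apply: sub; rewrite mem_cat xs orbT.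
have := stars_count m sub2 us2; have := stars_perm m s.
case: (stars m s) => base br /= pm cb go; rewrite ltnS.
rewrite -(permP pm).
have {}us : uniq (cur ++ (base ++ br)) by rewrite (perm_uniq (perm_cat (perm_refl cur) pm)).
have {}sub : {subset cur ++ (base ++ br) <= alle}.
  by move=> x; rewrite (perm_mem (perm_cat (perm_refl cur) pm)) => /sub.
(* Inner induction on the branching list; once it is empty, only the stars remain, and [cb] bounds
   them. *)
move: {pm} br us sub go; elim=> [|v br IHbr] us sub /=; first by rewrite cats0.
set s' := filter _ _.
have pv : perm_eq (v :: cur ++ (base ++ br)) (cur ++ (base ++ v :: br)).
  by apply/permP => f; rewrite /= !count_cat /= ![_ + (f v + _)]addnCA.
have us' : uniq (v :: cur ++ (base ++ br)) by rewrite (perm_uniq pv).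
have sub' : {subset v :: cur ++ (base ++ br) <= alle}.
  by move=> x; rewrite (perm_mem pv) => /sub.
have {}IHbr := IHbr _ _.
have cE : count inE2 (base ++ v :: br) = inE2 v + count inE2 (base ++ br).
  by rewrite !count_cat /= addnCA.
rewrite cE; case: ifP => // hs go.
(* A branching edge outside [E2] does not count, so the rest of the list decides. *)
case iv: (inE2 v); last first.
  rewrite add0n; apply: IHbr => //; first by case/andP: us'.
  by move=> x xs; apply: sub'; rewrite inE xs orbT.
rewrite add1n.
(* When v is in [E2], the other members of [E2] survive the filter by [compat_inE2]. *)
have : count inE2 (base ++ br) <= count inE2 s'.
  apply: count_leq => [|x xs ix].
    by move: us'; rewrite /= cat_uniq => /and4P[].
  rewrite mem_filter xs andbT -[mark_edge _ _]/(edges_matrix q.+1 (v :: cur)).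
  apply: compat_inE2; rewrite /= ?ix ?iv //.
    move=> y; rewrite !inE => /orP[/eqP->|/orP[/eqP->|yc]]; apply: sub'.
    + by rewrite in_cons mem_cat xs !orbT.
    + by rewrite mem_head.
    + by rewrite in_cons mem_cat yc orbT.
  move: us' => /=; rewrite cat_uniq mem_cat negb_or => /and4P[/andP[_ vs] _ /hasPn h _].
  by rewrite inE negb_or h // andbT; apply: contra vs => /eqP<-.
move/leq_ltn_trans; apply; move: hs.
(* The branch closes either because too few candidates are left or by the recursive search. *)
case: ltnP => [lt _|_].
  by apply: leq_ltn_trans lt; rewrite count_size.
apply: (IH (v :: cur)); first by rewrite /= iv.
- move=> x; rewrite /= inE mem_cat mem_filter => h; apply: sub'.
  by rewrite inE mem_cat; case/or3P: h => [->|->|/andP[_ ->]]; rewrite ?orbT.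
move: us'; rewrite cons_uniq cat_uniq mem_cat negb_or.
case/andP=> /andP[v1 v2] /and3P[u1 h2 u2].
rewrite /= cat_uniq mem_cat negb_or v1 mem_filter (negbTE v2) andbF u1 filter_uniq //.
rewrite andbT /=.
by apply: contra h2 => /hasP[x]; rewrite mem_filter => /andP[_ xs] xc; apply/hasP; exists x.
Qed.

(** By (S) the two halves of a 2-edge differ, so every member of [E2] is decoded from a listed
    pair. *)
Lemma card_count : #|E2| <= count inE2 alle.
Proof.
rewrite -size_filter -(size_map decode).
apply: leq_trans (card_size _).
apply/subset_leq_card/subsetP => D DE.
have /and4P[/forallP/(_ D) + /and3P[_ _ /forallP h] _ _] := admE2.
rewrite DE /= => /existsP[a /existsP[b /eqP eD]].
have := forallP (h a) b; rewrite -eD DE /= => /decode_onto[e he ee].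
by apply/mapP; exists e; rewrite ?mem_filter ?he ?andbT /inE2 ?ee -?eD.
Qed.

End Search.
End Edges.

(** * Relabelling and exhaustion *)

Section Relabelling.

Variables (q : nat) (p : nat -> 'I_q.+1) (s : seq nat).
Hypothesis p_inj : {in gtn q.+1 &, injective p}.
Hypothesis s_perm : perm_eq s (iota 0 q.+1).

Definition relabel (i : nat) : 'I_q.+1 := p (nth 0 s i).

Lemma perm_nth_lt i : i < q.+1 -> nth 0 s i < q.+1.
Proof.
move=> iq; have : nth 0 s i \in iota 0 q.+1.
  by rewrite -(perm_mem s_perm) mem_nth // (perm_size s_perm) size_iota.
by rewrite mem_iota.
Qed.

Lemma perm_nth_inj i j : i < q.+1 -> j < q.+1 ->
  nth 0 s i = nth 0 s j -> i = j.
Proof.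
move=> iq jq /eqP; rewrite nth_uniq ?(perm_size s_perm) ?size_iota //.
  by move/eqP.
by rewrite (perm_uniq s_perm) iota_uniq.
Qed.

Lemma relabel_inj : {in gtn q.+1 &, injective relabel}.
Proof.
move=> i j; rewrite !inE => iq jq /p_inj.
by rewrite !inE => /(_ (perm_nth_lt iq) (perm_nth_lt jq)) /perm_nth_inj; apply.
Qed.

(** Acting on codes by s amounts to composing the labelling with s; [encodeP] reduces both sides to
    the same row ends and the same column. *)
Lemma act_encode k x : k \in codes q.+1 ->
  (encode p x == act q.+1 s k) = (encode relabel x == k).
Proof.
move=> kc; have := kc; rewrite mem_codes => /andP[k1 k2].
have := row_ends_lt k1; have := row_ends_lt1 k1; have := row_ends_lt2 k1.
have e1 := encodeP relabel_inj x kc; move: e1; rewrite /act.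
case: (nth (0, 0) (row_pairs q.+1) k.1) => i j /= e1 jq iq /andP[ij _].
set ij' := if _ then _ else _.
have hij : ij' \in row_pairs q.+1.
  rewrite mem_row_pairs /ij'; case: (ltngtP (nth 0 s i) (nth 0 s j)) => [lt|lt|] /=;
    rewrite ?lt ?perm_nth_lt //.
  by move/(perm_nth_inj iq jq) => eij; rewrite eij ltnn in ij.
have kc' : (index ij' (row_pairs q.+1), nth 0 s k.2) \in codes q.+1.
  by rewrite mem_codes /= index_mem hij perm_nth_lt.
have e2 := encodeP p_inj x kc'; rewrite /= nth_index // in e2.
(* Sorting the two ends does not change the row as a set. *)
have ee : [set p ij'.1; p ij'.2] = [set relabel i; relabel j].
  by rewrite /ij'; case: ifP; rewrite //= setUC.
apply/eqP/eqP => [/e2|/e1].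
  by rewrite ee => h; apply/e1.
by move=> h; apply/e2; rewrite ee.
Qed.

Lemma decode_acte e : e \in pairs (codes q.+1) -> decode p (acte q.+1 s e) = decode relabel e.
Proof.
move=> /mem_pairs_codes /andP[h1 h2]; apply/setP => x.
by rewrite !inE /thru /acte /= ![_ == encode _ _]eq_sym !act_encode.
Qed.

End Relabelling.

Lemma decode_swap q (p : nat -> 'I_q.+1) k l : decode p (k, l) = decode p (l, k).
Proof. by apply/setP => x; rewrite !inE /thru /= orbC. Qed.

(** The fixed representative replaces any edge of its orbit at the price of a new labelling, here
    [relabel p s]. *)
Lemma orbit_edges_relabel q (p : nat -> 'I_q.+1) (E2 : {set {set cell q}}) r e :
  {in gtn q.+1 &, injective p} -> r \in pairs (codes q.+1) ->
  e \in orbit_edges q.+1 r -> inE2 p E2 e ->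
  exists2 p' : nat -> 'I_q.+1, {in gtn q.+1 &, injective p'} & inE2 p' E2 r.
Proof.
move=> pi hr /flatten_mapP[s /perms_of_perm hs he] ie.
exists (relabel p s); first exact: relabel_inj.
rewrite /inE2 -decode_acte //; move: he ie; rewrite !inE /inE2.
by case/orP=> /eqP-> //; rewrite decode_swap.
Qed.

Lemma inord_inj q : {in gtn q.+1 &, injective (@inord q)}.
Proof.
by move=> i j; rewrite !inE => iq jq /(congr1 val) /=; rewrite !inordK.
Qed.

(** Induction on the representatives. The assumption on [done] ranges over all labellings, so it
    survives the relabelling that brings [r] into [E2]. *)
Lemma exhaust_card q (E2 : {set {set cell q}}) m done reps : admissible E2 ->
  (forall p : nat -> 'I_q.+1, {in gtn q.+1 &, injective p} ->
     forall e, e \in done -> ~~ inE2 p E2 e) ->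
  exhaust q.+1 m done reps -> #|E2| <= m.
Proof.
move=> adm; elim: reps done => [|r reps IH] done hd.
  (* With no representative left, every pair admissible on its own is in [done], so [E2] is
     empty. *)
  move=> /allP h; apply: leq_trans (card_count (@inord_inj q) adm) _.
  suff : ~~ has (inE2 inord E2) (pairs (codes q.+1)).
    by rewrite has_count -eqn0Ngt => /eqP->.
  apply/hasPn => e he; apply/negP => ie.
  have := h e he; rewrite -[E1_matrix _]/(edges_matrix q.+1 [::]).
  rewrite (compat_inE2 (@inord_inj q) adm) /= ?ie //.
    by move/(hd _ (@inord_inj q)); rewrite ie.
  by move=> x; rewrite inE => /eqP->.
(* If [E2] has more than m elements, no labelling puts [r] in it, so the whole orbit of [r] may join
   [done]. *)
case/and3P=> hr hs; case: leqP => // lt_m hx; have := lt_m; rewrite ltnNge => /negP[].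
apply: IH hx => p pi e; rewrite mem_cat => /orP[|/hd]; last exact.
move=> eo; apply/negP => /(orbit_edges_relabel pi hr eo)[p' p'i ir].
move: lt_m; rewrite ltnNge => /negP[]; apply: leq_trans (card_count p'i adm) _.
have ua := pairs_uniq (codes_uniq q.+1).
(* [r] is one member of [E2]; the search shows that the others number fewer than m. *)
rewrite (permP (perm_to_rem hr)) /= ir add1n.
set s := [seq e <- _ | _] in hs.
have sub x : x \in s -> x \in pairs (codes q.+1).
  by rewrite !mem_filter => /and3P[].
apply: leq_ltn_trans (search_count p'i adm _ _ _ hs); last 3 first.
- by rewrite /= ir.
- by move=> x; rewrite inE => /orP[/eqP->|/sub].
- rewrite -[_ ++ _]/(r :: s) cons_uniq !filter_uniq // !mem_filter.
  (* [r] itself fails [compat], its own cells being marked already. *)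
  by rewrite /compat get_mark_edge /thru eqxx /= !andbF.
apply: count_leq => [|x]; first exact: rem_uniq.
rewrite mem_rem_uniq // inE => /andP[xr xa] ix.
rewrite !mem_filter xa andbT; apply/andP; split.
  by apply: contraL ix => /(hd _ p'i).
apply: (compat_inE2 p'i adm (cur := [:: r])); rewrite /= ?ix ?ir ?inE //.
by move=> y; rewrite !inE => /orP[] /eqP->.
Qed.

(** * Explicit admissible sets *)

(** Lets a 2-edge, which is unordered, be tested in either order of its halves. *)
Lemma conflict_sym q (O : {set cell q}) a b : conflict O a b = conflict O b a.
Proof.
rewrite /conflict /nondegenerate (eq_sym a.1) (eq_sym a.2) [X in _ && X]andbC.
congr (_ || _); apply: eq_existsb => x; apply: eq_existsb => y.
have -> : (x \in [:: a.1; b.1]) = (x \in [:: b.1; a.1]) by rewrite !inE orbC.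
have -> : (y \in [:: a.2; b.2]) = (y \in [:: b.2; a.2]) by rewrite !inE orbC.
do 2!congr (_ && _); apply: perm_all; rewrite perm_cons; apply/permP => f /=.
by rewrite addnCA [X in _ + (_ + X)]addnCA.
Qed.

Section Witness.

Variables (q : nat) (w : seq edge).
Hypothesis w_ok : witness q.+1 w.

Local Notation p := (@inord q).
Local Notation pi := (@inord_inj q).

Definition witness_set : {set {set cell q}} := [set:: map (decode p) w].

Lemma witness_cells e : e \in w -> exists a b, e = (encode p a, encode p b) /\ a != b.
Proof.
move=> ew; have /and3P[/allP hc hu _] := w_ok.
have h k : k \in [:: e.1; e.2] -> k \in codes q.+1.
  move=> ke; have /hc/andP[//] : k \in halves w.
  by apply/flatten_mapP; exists e.
have [a ea] := encode_surj pi (h _ (mem_head _ _)).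
have [|b eb] := encode_surj pi (h e.2 _); first by rewrite !inE eqxx orbT.
exists a, b; split; first by rewrite ea eb; case: (e).
move: hu; rewrite /halves; case/path.splitPr: ew => w1 w2.
rewrite map_cat flatten_cat /= cat_uniq => /and3P[_ _ /= /andP[+ _]].
by rewrite inE negb_or -ea -eb (inj_eq (encode_inj pi)) => /andP[].
Qed.

Lemma witness_thru k e f : e \in w -> f \in w -> thru k e -> thru k f -> e = f.
Proof.
have /and3P[_ + _] := w_ok; rewrite /halves.
elim: w => //= g w' IH /= /and3P[h1 h2 hu]; rewrite !inE => eg fg ke kf.
have out x : x \in w' -> thru k x -> ~~ thru k g.
  move=> xw kx; have : k \in flatten [seq [:: e.1; e.2] | e <- w'].
    by apply/flatten_mapP; exists x; rewrite // !inE ![k == _]eq_sym.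
  move=> kw; apply/norP; split; apply/eqP => ek; subst k.
    by move: h1; rewrite inE kw orbT.
  by rewrite kw in h2.
case/orP: eg fg => [/eqP eg|ew] /orP[/eqP fg|fw]; first by rewrite eg fg.
- by have := out f fw kf; rewrite -eg ke.
- by have := out e ew ke; rewrite -fg kf.
exact: IH.
Qed.

Lemma witness_admissible : admissible witness_set.
Proof.
have memw D : (D \in witness_set) -> exists2 e, e \in w & D = decode p e.
  by rewrite inE => /mapP[e ew ->]; exists e.
have /and3P[hc hu hb] := w_ok.
apply: conflict_admissible.
- apply/forallP => D; apply/implyP => /memw[e /witness_cells[a [b [-> _]]] ->].
  by apply/existsP; exists a; apply/existsP; exists b; rewrite (decode_encode pi).
- apply/and3P; split.
  + apply/forallP => D; apply/implyP => /memw[e ew ->].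
    apply/pred0P => x; apply/negbTE; rewrite /= -(marked_E1_matrix pi) !inE negb_and.
    case te: (thru _ _) => //=.
    have /(allP hc)/andP[//] : encode p x \in halves w.
    by apply/flatten_mapP; exists e; rewrite // !inE ![encode p x == _]eq_sym.
  + apply/trivIsetP => _ _ /memw[e ew ->] /memw[f fw ->] ne.
    apply/pred0P => x; apply/negbTE/negP => /=; rewrite !inE => /andP[xe xf].
    by rewrite (witness_thru ew fw xe xf) eqxx in ne.
  apply/forallP => a; apply/forallP => b; apply/implyP => /memw[e].
  case/witness_cells=> c [d [-> cd]]; rewrite (decode_encode pi) => eab.
  by apply: contraTN cd => /eqP ab; have := cards2 c d; rewrite -eab ab cards2 eqxx; case: (c == d).
move=> a b /memw[e ew eab].
have [c [d [ecd _]]] := witness_cells ew.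
have szM : size (edges_matrix q.+1 w) = size (row_pairs q.+1).
  by apply: size_edges_matrix; apply/allP => k /(allP hc)/andP[].
have := allP hb e ew; rewrite ecd (violatesE pi) // (marked_edges_matrix pi).
rewrite -[E1 q :|: _]/(occupied witness_set).
(* Equality of the two unordered pairs leaves the straight and the crossed match; the latter is
   settled by [conflict_sym]. *)
move: eab; rewrite ecd (decode_encode pi) => eab.
have : a \in [set c; d] by rewrite -eab !inE eqxx.
have : b \in [set c; d] by rewrite -eab !inE eqxx orbT.
have : c \in [set a; b] by rewrite eab !inE eqxx.
have : d \in [set a; b] by rewrite eab !inE eqxx orbT.
rewrite !inE => hd hc' /orP[] /eqP eb /orP[] /eqP ea; subst a b => //.
- by move: hd; rewrite orbb => /eqP->.
- by rewrite conflict_sym.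
by move: hc'; rewrite orbb => /eqP->.
Qed.

Lemma card_witness_set : #|witness_set| = size w.
Proof.
rewrite -(size_map (decode p)) cardsE; apply/card_uniqP.
rewrite map_inj_in_uniq => [|e f ew fw ef].
  have /and3P[_ + _] := w_ok; rewrite /halves; elim: w => //= g w' IH.
  case/and3P=> h1 _ /IH->; rewrite andbT; apply: contra h1 => gw.
  rewrite inE; apply/orP; right; apply/flatten_mapP; exists g => //.
  exact: mem_head.
have [a [b [ee _]]] := witness_cells ew.
have te : thru (encode p a) e by rewrite ee /thru eqxx.
apply: (witness_thru ew fw te).
by have : a \in decode p f; [rewrite -ef inE | rewrite inE].
Qed.

End Witness.

(** * The number of 1-edges and the bounds on [L] *)

Lemma card_E1 q : #|E1 q| = q * q.+1.
Proof.
have -> : #|E1 q| = \sum_(r : row q) \sum_(c in val r) 1.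
  by rewrite pair_big_dep /= -sum1_card; apply: eq_bigl => x; rewrite inE.
rewrite (eq_bigr (fun=> 2)); last by move=> r _; rewrite sum1_card; apply/eqP/(valP r).
rewrite sum_nat_const card_sig -(eq_card (in_set _)) card_draws card_ord.
by rewrite -[LHS]/('C(q.+1, 2) * 2`!) bin_ffact !ffactnS ffactn0 muln1 mulnC.
Qed.

(** Adding a constant commutes with a maximum over a nonempty family; the empty list of 2-edges
    provides a member. *)
Lemma L_split q :
  L q = q * q.+1 + \max_(E2 : {set {set cell q}} | admissible E2) #|E2|.
Proof.
have adm0 : admissible (witness_set q [::]) by exact: witness_admissible.
have [|E adm maxE] := @eq_bigmax_cond _ [pred E2 | @admissible q E2] (fun E2 => #|E2|).
  by apply/card_gt0P; exists (witness_set q [::]).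
rewrite /L card_E1; apply/eqP; rewrite eqn_leq; apply/andP; split.
  apply/bigmax_leqP => E' adm'; rewrite leq_add2l.
  exact: (@leq_bigmax_cond _ _ (fun E2 : {set {set cell q}} => #|E2|)).
rewrite maxE.
exact: (@leq_bigmax_cond _ _ (fun E2 : {set {set cell q}} => q * q.+1 + #|E2|)).
Qed.

Lemma L_lower q w : witness q.+1 w -> q * q.+1 + size w <= L q.
Proof.
move=> ok; rewrite -(card_witness_set ok) -card_E1.
have := witness_admissible ok.
exact: (@leq_bigmax_cond _ _ (fun E2 : {set {set cell q}} => #|E1 q| + #|E2|)).
Qed.

Lemma L_upper q m reps : exhaust q.+1 m [::] reps -> L q <= q * q.+1 + m.
Proof.
move=> ex; apply/bigmax_leqP => E2 adm; rewrite card_E1 leq_add2l.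
exact: (exhaust_card adm _ ex).
Qed.

(** For q = 3, every 2-edge that is admissible on its own serves as a representative, without a
    choice of orbits. *)
Definition reps_q3 : seq edge := [seq e <- pairs (codes 4) | compat 4 [::] (E1_matrix 4) e].
(* The rows of K_5 are numbered 01, 02, 03, 04, 12, 13, 14, 23, 24, 34. *)
Definition reps_q4 : seq edge :=
  [:: ((9, 1), (9, 2)); ((8, 1), (9, 0)); ((8, 3), (9, 1)); ((6, 0), (7, 0));
      ((6, 3), (7, 0))].
Definition edges_q3 : seq edge :=
  [:: ((2, 1), (5, 0)); ((0, 2), (3, 3))].
Definition edges_q4 : seq edge :=
  [:: ((1, 4), (2, 2)); ((1, 1), (7, 4)); ((0, 2), (8, 3)); ((4, 3), (6, 0));
      ((4, 0), (9, 1)); ((3, 3), (5, 2))].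
Definition edges_q5 : seq edge :=
  [:: ((5, 4), (13, 0)); ((0, 4), (4, 2)); ((2, 1), (13, 2)); ((9, 0), (14, 1));
      ((1, 3), (12, 1)); ((1, 5), (3, 1)); ((7, 3), (14, 2)); ((6, 4), (9, 5));
      ((0, 3), (5, 5)); ((2, 4), (11, 1)); ((4, 3), (8, 4)); ((6, 0), (8, 2));
      ((3, 3), (10, 5))].
Definition edges_q6 : seq edge :=
  [:: ((3, 3), (5, 5)); ((9, 4), (10, 3)); ((11, 5), (14, 4)); ((3, 2), (5, 1));
      ((9, 0), (10, 2)); ((11, 1), (14, 0)); ((4, 1), (14, 3)); ((5, 4), (7, 2));
      ((10, 5), (12, 0)); ((2, 4), (16, 1)); ((8, 5), (15, 2)); ((13, 3), (18, 0));
      ((15, 0), (20, 1)); ((16, 2), (19, 0)); ((17, 2), (18, 1)); ((0, 5), (13, 6));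
      ((1, 4), (8, 6)); ((2, 6), (6, 3)); ((0, 4), (20, 3)); ((1, 3), (19, 5));
      ((6, 5), (17, 4)); ((4, 4), (20, 2)); ((7, 5), (17, 0)); ((12, 3), (19, 1))].
Definition edges_q7 : seq edge :=
  [:: ((0, 3), (3, 2)); ((3, 6), (22, 7)); ((6, 2), (21, 1)); ((7, 4), (10, 3));
      ((10, 7), (25, 0)); ((13, 5), (16, 4)); ((16, 0), (27, 1)); ((18, 6), (21, 5));
      ((0, 2), (5, 3)); ((1, 5), (13, 4)); ((6, 1), (26, 2)); ((7, 3), (12, 4));
      ((8, 6), (18, 5)); ((14, 7), (22, 6)); ((19, 0), (25, 7)); ((23, 1), (27, 0));
      ((0, 5), (11, 2)); ((2, 4), (13, 7)); ((4, 1), (6, 4)); ((7, 6), (17, 3));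
      ((9, 5), (18, 0)); ((15, 6), (22, 1)); ((20, 7), (25, 2)); ((24, 0), (27, 3));
      ((1, 6), (20, 1)); ((2, 6), (26, 3)); ((4, 3), (14, 0)); ((5, 4), (9, 7));
      ((8, 7), (24, 2)); ((11, 4), (19, 1)); ((12, 5), (15, 0)); ((17, 5), (23, 2))].

Lemma exhaust_q3 : exhaust 4 2 [::] reps_q3.
Proof. by vm_compute. Qed.

Lemma exhaust_q4 : exhaust 5 6 [::] reps_q4.
Proof. by vm_compute. Qed.

Theorem mainTheorem2 :
  (forall q : nat, 2 <= q ->
     L q = q * q.+1 +
           \max_(E2 : {set {set cell q}} | admissible E2) #|E2|) /\
  L 3 = 14 /\ L 4 = 26 /\ 43 <= L 5 /\ 64 <= L 6 /\ 88 <= L 7.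
Proof.
split=> [q _|]; first exact: L_split.
split; first by apply/eqP; rewrite eqn_leq (L_upper exhaust_q3) (@L_lower 3 edges_q3).
split; first by apply/eqP; rewrite eqn_leq (L_upper exhaust_q4) (@L_lower 4 edges_q4).
split; first exact: (@L_lower 5 edges_q5).
split; last exact: (@L_lower 7 edges_q7).
(* The set found gives 42 + 24 = 66, which is above the 64 required. *)
exact: leq_trans (@L_lower 6 edges_q6 isT).
Qed.
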